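(* Let $Q_1,Q_2,\dots,Q_L$ be mutually absolutely continuous probability distributions on $\mathcal X$. Fix $\theta\in\Theta$ and $\alpha\in(0,1)$, and let $\pi_\theta(\cdot,\cdot)$ be a data-dependent p-value. Suppose that $$\mathbb P\bigl(\pi_\theta(X,\mathcal D)\le\alpha\,\big|\,Y=\theta,\mathcal D\bigr)\le\alpha\quad\text{almost surely}$$ whenever $(P_1,P_2,\dots,P_L)$ is a permutation of $(Q_1,Q_2,\dots,Q_L)$. In that case, for arbitrary $b\in\Theta$, and whenever $(P_1,\dots,P_L)$ is a permutation of $(Q_1,\dots,Q_L)$, $$\mathbb P\bigl(\pi_\theta(X,\mathcal D)\le\alpha\,\big|\,Y=b,\mathcal D\bigr)\le\alpha\quad\text{almost surely}.$$
   Context: $\mathcal X$ is a measurable space and $\Theta=\{1,\dots,L\}$, $L\ge2$. $(X,Y)$ is a random pair in $\mathcal X\times\Theta$ with $P_b:=\mathcal L(X\,|\,Y=b)$ for $b\in\Theta$. The training data $\mathcal D$ consist of $(X_1,Y_1),\dots,(X_n,Y_n)$, where the labels $Y_1,\dots,Y_n\in\Theta$ are regarded as fixed (non-random), $X_1,\dots,X_n$ and $(X,Y)$ are independent, and $\mathcal L(X_i)=P_{Y_i}$. A data-dependent p-value is a measurable function $(x,\mathcal D)\mapsto\pi_\theta(x,\mathcal D)\in[0,1]$ of a feature vector and the training data; the same function is used for all choices of $(P_1,\dots,P_L)$. By independence, $\mathbb P(\pi_\theta(X,\mathcal D)\le\alpha\,|\,Y=b,\mathcal D)=P_b\{x\in\mathcal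 X:\pi_\theta(x,\mathcal D)\le\alpha\}$, and ''almost surely'' refers to the distribution of $\mathcal D$. *)

(* Defs.v *)
From HB Require Import structures.
From mathcomp Require Import all_boot all_order all_algebra all_fingroup.
From mathcomp Require Import all_classical all_reals all_analysis.

Set Implicit Arguments.
Unset Strict Implicit.
Unset Printing Implicit Defensive.
Import Order.TTheory GRing.Theory Num.Theory.
Import numFieldNormedType.Exports.

Local Open Scope classical_set_scope.
Local Open Scope ring_scope.

(* The L >= 2 class labels 1,...,L are the elements of ['I_K.+2], K = L - 2,
   with the discrete sigma-algebra; measurable types have to be nonempty, whence
   the successor in ['I_K.+1]. *)
HB.instance Definition _ (K : nat) := isPointed.Build 'I_K.+1 ord0.
HB.instance Definition _ (K : nat) := @isMeasurable.Build
  default_measure_display 'I_K.+1 (@discrete_measurable 'I_K.+1)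
  (@discrete_measurable0 'I_K.+1) (@discrete_measurableC 'I_K.+1)
  (@discrete_measurableU 'I_K.+1).

Definition mutually_abs_continuous d (T : measurableType d) (R : realType)
    (K : nat) (Q : 'I_K.+1 -> probability T R) : Prop :=
  forall a b, Q a `<< Q b.

(* A probability space carrying the training features [train i] (with fixed
   labels [y]) and the pair [(feature, label)] to be classified, such that
   [P b] is the conditional law of [feature] given [label = b]; positivity of
   the class probabilities is what makes all these conditional laws defined. *)
Record classification_model d (T : measurableType d) (R : realType)
    (K n : nat) (y : n.-tuple 'I_K.+1) (P : 'I_K.+1 -> probability T R) := {
  disp : measure_display ;
  space : measurableType disp ;
  prob : probability space R ;
  train : 'I_n -> space -> T ;
  feature : space -> T ;
  label : space -> 'I_K.+1 ;
  measurable_train : forall i, measurable_fun [set: space] (train i) ;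
  measurable_feature : measurable_fun [set: space] feature ;
  measurable_label : measurable_fun [set: space] label ;
  train_law : forall i (A : set T), measurable A ->
    prob (train i @^-1` A) = P (tnth y i) A ;
  label_gt0 : forall b, (0 < prob (label @^-1` [set b]))%E ;
  feature_law : forall b (A : set T), measurable A ->
    (prob (feature @^-1` A `&` label @^-1` [set b])
      = P b A * prob (label @^-1` [set b]))%E ;
  (* mutual independence of the [train i] and of the pair [(feature, label)] *)
  independence : forall (A : 'I_n -> set T) (E : set (T * 'I_K.+1)),
    (forall i, measurable (A i)) -> measurable E ->
    (prob ((\bigcap_i (train i @^-1` A i))
           `&` [set w | E (feature w, label w)])
      = (\prod_(i < n) prob (train i @^-1` A i))
        * prob [set w | E (feature w, label w)])%E }.

Definition training_data d (T : measurableType d) (R : realType)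
    (K n : nat) (y : n.-tuple 'I_K.+1) (P : 'I_K.+1 -> probability T R)
    (M : classification_model y P) (w : space M) : n.-tuple (T * 'I_K.+1) :=
  [tuple (train i w, tnth y i) | i < n].

(* [g] is a version of the conditional probability [Pr (A | B, D)], written as
   a function of the value of [D]: the conditional probability of [A] given
   the random element [D] under the law [Pr ( . | B)] (for [Pr B > 0]), with
   the factor [Pr B] cleared from both sides of the defining equation. *)
Definition is_cond_prob d (Omega : measurableType d) (R : realType)
    (Pr : probability Omega R) d' (S : measurableType d')
    (A B : set Omega) (D : Omega -> S) (g : S -> R) : Prop :=
  measurable_fun [set: S] g /\
  forall C : set S, measurable C ->
    (Pr (A `&` B `&` D @^-1` C)
      = \int[Pr]_(w in B `&` D @^-1` C) (g (D w))%:E)%E.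

Definition p_value d (T : measurableType d) (R : realType) (K n : nat)
    (p : T * n.-tuple (T * 'I_K.+1) -> R) : Prop :=
  measurable_fun [set: T * n.-tuple (T * 'I_K.+1)] p /\ (forall z, 0 <= p z <= 1).

(* P(p(X,D) <= alpha | Y = b, D) <= alpha almost surely; conditional
   probabilities being defined up to null sets, this is required of every
   version. *)
Definition cond_level_le d (T : measurableType d) (R : realType)
    (K n : nat) (y : n.-tuple 'I_K.+1) (P : 'I_K.+1 -> probability T R)
    (M : classification_model y P)
    (p : T * n.-tuple (T * 'I_K.+1) -> R) (b : 'I_K.+1) (alpha : R) : Prop :=
  forall g : n.-tuple (T * 'I_K.+1) -> R,
    is_cond_prob (prob M)
      [set w | p (feature w, training_data w) <= alpha]
      [set w : space M | label w = b]
      (fun w : space M => training_data w) g ->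
    {ae prob M, forall w, g (training_data w) <= alpha}.

(* Main.v *)
From Pilot Require Import Defs.
From HB Require Import structures.
From mathcomp Require Import all_boot all_order all_algebra all_fingroup.
From mathcomp Require Import all_classical all_reals all_analysis.
From mathcomp Require Import measurable_realfun.

(** Let [P_c = Q (s c)] be the class laws of the given model. Write [D] for the
    training data and [H t] for the probability that [P_b] gives to the set of
    the [x] with [p (x, t) <= alpha]. By independence [H] is a version of the
    conditional probability of the event [p (X, D) <= alpha] given [Y = b] and
    [D] ([section_is_cond_prob]), so what has to be shown is [H D <= alpha]
    almost surely.

    The set of the [t] with [H t > alpha] mentions only the law [P_b], not the
    index [b] under which this law occurs. Compose [s] with the transposition
    of [theta] and [b]: in a model [M'] with the class laws [Q (s' c)] so
    obtained, the class [theta] has the law [Q (s' theta) = Q (s b) = P_b], and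
    the same [H] is a version of the conditional probability given [Y = theta]
    and [D]. The assumed level at [theta], applied to [M'], says that [H > alpha]
    is a null event for the training data of [M'].

    It remains to go back from [M'] to the given model. In both models the
    training features are independent, with laws taken from the mutually
    absolutely continuous family [Q], and a product of finitely many
    probabilities is dominated by the product of dominating ones
    ([product_law_dominates]). So [H > alpha] is also a null event for the
    training data of the given model.

    Two supporting facts are needed. A model with prescribed class laws exists
    ([product_model]): otherwise the assumption would say nothing. And a bound
    for one nonnegative version of a conditional probability is a bound for all
    versions ([cond_level_le_of_version]). *)

Set Implicit Arguments.
Unset Strict Implicit.
Unset Printing Implicit Defensive.
Import Order.TTheory GRing.Theory Num.Theory.

Local Open Scope classical_set_scope.
Local Open Scope ring_scope.

(** * Boxes in spaces of tuples *)

Section boxes.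
Context d (T : measurableType d) (R : realType) (n : nat).
Implicit Type A : 'I_n -> set T.

Definition box A : set (n.-tuple T) := [set t | forall i, A i (tnth t i)].

Lemma measurable_box A : (forall i, measurable (A i)) -> measurable (box A).
Proof.
move=> mA.
rewrite (_ : box A = \bigcap_(i in [set: 'I_n]) ((@tnth n T)^~ i @^-1` A i)).
  apply: fin_bigcap_measurable => // i _.
  by rewrite -[X in measurable X]setTI; exact: measurable_tnth.
by apply/seteqP; split=> t /= At i; [move=> _|]; exact: At.
Qed.

Lemma measurable_tuple_boxes :
  @measurable _ (n.-tuple T) =
  <<s [set box A | A in [set A | forall i, measurable (A i)]] >>.
Proof.
rewrite eqEsubset; split.
- apply: smallest_sub; first exact: smallest_sigma_algebra.
  rewrite -bigcup_seq/=; apply: bigcup_sub => i _ _ [B mB <-].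
  apply: sub_sigma_algebra.
  exists (fun j => if j == i then B else setT) => [j/=|]; first by case: ifP.
  rewrite setTI; apply/seteqP; split=> t /= Bt => [|j].
    by have := Bt i; rewrite eqxx.
  by case: eqP => [->|].
- apply: smallest_sub; first exact: sigma_algebra_measurable.
  by move=> _ [A mA <-]; exact: measurable_box.
Qed.

(** The boxes are a generating pi-system that contains the whole space. *)
Lemma box_measure_unique (m1 m2 : {measure set (n.-tuple T) -> \bar R}) :
  (m1 setT < +oo)%E ->
  (forall A, (forall i, measurable (A i)) -> m1 (box A) = m2 (box A)) ->
  forall C, measurable C -> m1 C = m2 C.
Proof.
move=> m1T m12 C mC.
apply: (measure_unique _ (fun=> setT) measurable_tuple_boxes) => //.
- move=> _ _ [A mA <-] [B mB <-]; exists (fun i => A i `&` B i) => [i /=|].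
    exact: measurableI.
  apply/seteqP; split=> [t ABt|t [At Bt] i]; last by split; [exact: At|exact: Bt].
  by split=> i; have [] := ABt i.
- by move=> _; exists (fun=> setT) => //; apply/seteqP; split.
- by rewrite bigcup_const.
- by move=> _ [A mA <-]; exact: m12.
Qed.

End boxes.

(** * Finite products of probabilities and absolute continuity *)

(** By Tonelli, a set is null for a product if and only if almost all of its
    sections are null, and both occurrences of nullity pass to dominated
    probabilities. *)
Lemma dominates_product d1 d2 (T1 : measurableType d1) (T2 : measurableType d2)
    (R : realType) (P1 P2 : probability T1 R) (Q1 Q2 : probability T2 R) :
  P1 `<< P2 -> Q1 `<< Q2 -> (P1 \x Q1)%E `<< (P2 \x Q2)%E.
Proof.
move=> /null_content_dominatesP P12 /null_content_dominatesP Q12.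
apply/null_content_dominatesP => A mA A0.
pose sec (Q : probability T2 R) (x : T1) : \bar R := Q (xsection A x).
have msec Q : measurable_fun setT (sec Q) by exact: measurable_fun_xsection.
have /(ae_eq_integral_abs P2 measurableT (msec Q2))[N [mN N0 subN]] :
    (\int[P2]_x `|sec Q2 x| = 0)%E.
  by rewrite -[RHS]A0; apply: eq_integral => x _; rewrite gee0_abs.
have : (\int[P1]_x `|sec Q1 x| = 0)%E.
  apply/ae_eq_integral_abs => //; exists N; split=> //; first exact: P12.
  move=> x nQ1; apply: subN => Q20; apply: nQ1 => _ /=.
  by apply: Q12; [exact: measurable_xsection|exact: Q20].
by move=> <-; apply: eq_integral => x _; rewrite gee0_abs.
Qed.

Lemma dominates_distribution d1 d2 (T1 : measurableType d1)
    (T2 : measurableType d2) (R : realType) (P1 P2 : probability T1 R)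
    (X : {mfun T1 >-> T2}) :
  P1 `<< P2 -> distribution P1 X `<< distribution P2 X.
Proof.
move=> /null_content_dominatesP P12; apply/null_content_dominatesP => A mA A0.
by apply: P12 => //; exact: measurable_funPTI.
Qed.

Section cons_law.
Context d (T : measurableType d) (n : nat).

Definition cons_pair (z : T * n.-tuple T) : n.+1.-tuple T :=
  [tuple of z.1 :: z.2].

Let measurable_cons_pair : measurable_fun [set: T * n.-tuple T] cons_pair.
Proof. exact: measurable_cons. Qed.

HB.instance Definition _ :=
  isMeasurableFun.Build _ _ _ _ cons_pair measurable_cons_pair.

Definition cons_law (R : realType) (P : probability T R)
    (mu : probability (n.-tuple T) R) : probability (n.+1.-tuple T) R :=
  distribution (P \x mu)%E cons_pair.

End cons_law.

Section product_law.
Context d (T : measurableType d) (R : realType).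

Definition is_product_law n (F : 'I_n -> probability T R)
    (mu : {measure set (n.-tuple T) -> \bar R}) :=
  forall A, (forall i, measurable (A i)) ->
    mu (box A) = (\prod_(i < n) F i (A i))%E.

Lemma product_law_unique n (F : 'I_n -> probability T R)
    (mu nu : probability (n.-tuple T) R) :
  is_product_law F mu -> is_product_law F nu ->
  forall C, measurable C -> mu C = nu C.
Proof.
move=> muF nuF C; apply: box_measure_unique => [|A mA].
  by rewrite ltey_eq fin_num_measure.
by rewrite muF// nuF.
Qed.

Lemma cons_law_product n (F : 'I_n.+1 -> probability T R)
    (mu : probability (n.-tuple T) R) :
  is_product_law (fun i => F (lift ord0 i)) mu ->
  is_product_law F (cons_law (F ord0) mu).
Proof.
move=> muE A mA; rewrite big_ord_recl -muE => [|i]; last exact: mA.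
rewrite -product_measure1E//; last by apply: measurable_box => i; exact: mA.
rewrite /cons_law /distribution /pushforward /=; congr ((_ \x _)%E _).
apply/seteqP; split=> [[x t] At|[x t] [/= Ax At] i].
  by split=> [|i]; [exact: (At ord0)|have := At (lift ord0 i); rewrite tnthS].
by case: (unliftP ord0 i) => [j ->|->//]; rewrite tnthS; exact: At.
Qed.

(** The two product laws are built coordinate by coordinate and in parallel, so
    that a single induction yields their existence and the domination. *)
Lemma dominated_product_laws n (F G : 'I_n -> probability T R) :
  (forall i, F i `<< G i) ->
  exists mu nu : probability (n.-tuple T) R,
    [/\ is_product_law F mu, is_product_law G nu & mu `<< nu].
Proof.
elim: n F G => [|n IHn] F G FG.
  have dirac_law (H : 'I_0 -> probability T R) :
      is_product_law H (dirac [tuple] : probability (0.-tuple T) R).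
    by move=> A _; rewrite big_ord0 /= diracE mem_set// => -[].
  by exists (dirac [tuple]), (dirac [tuple]); split.
have [//|mu [nu [muF nuG munu]]] :=
  IHn (fun i => F (lift ord0 i)) (fun i => G (lift ord0 i)).
exists (cons_law (F ord0) mu), (cons_law (G ord0) nu).
split; [exact: cons_law_product|exact: cons_law_product|].
by apply: dominates_distribution; exact: dominates_product.
Qed.

Lemma product_law_exists n (F : 'I_n -> probability T R) :
  exists mu : probability (n.-tuple T) R, is_product_law F mu.
Proof.
have FF i : F i `<< F i by [].
by have [mu [nu [muF _ _]]] := dominated_product_laws FF; exists mu.
Qed.

Lemma product_law_dominates n (F G : 'I_n -> probability T R)
    (mu nu : probability (n.-tuple T) R) :
  (forall i, F i `<< G i) -> is_product_law F mu -> is_product_law G nu ->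
  mu `<< nu.
Proof.
move=> FG muF nuG.
have [mu' [nu' [muF' nuG' /null_content_dominatesP munu']]] :=
  dominated_product_laws FG.
apply/null_content_dominatesP => C mC nuC.
rewrite (product_law_unique muF muF')//; apply: munu' => //.
by rewrite -nuC; exact: (product_law_unique nuG').
Qed.

End product_law.

(** * The law of a random element on an event *)

Lemma integral_mrestr d (T : measurableType d) (R : realType)
    (mu : {measure set T -> \bar R}) (D : set T) (mD : measurable D)
    (f : T -> \bar R) :
  measurable_fun setT f -> (forall x, 0 <= f x)%E ->
  (\int[mrestr mu mD]_x f x = \int[mu]_(x in D) f x)%E.
Proof.
move=> mf f0.
have rC0 : mrestr mu mD (~` D) = 0%E by rewrite /mrestr setIC setICr measure0.
rewrite (@ge0_negligible_integral _ _ _ (mrestr mu mD) _ _ _ _ _ mf _ rC0)//.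
- rewrite setDE setTI setCK; apply: eq_measure_integral => A mA AD.
  by rewrite /= /mrestr setIidl.
- exact: measurableC.
Qed.

Section law_on.
Context d1 d2 (T1 : measurableType d1) (T2 : measurableType d2) (R : realType).
Context (P : probability T1 R) (D : set T1) (mD : measurable D).
Context (X : {mfun T1 >-> T2}).

(** The unnormalized conditional law of [X] given [D]: a finite measure, so that
    the uniqueness theorems for finite measures apply without dividing by
    [P D], which may be zero. *)
Definition law_on : set T2 -> \bar R := pushforward (mrestr P mD) X.

Let law_on0 : law_on set0 = 0%E. Proof. exact: measure0. Qed.

Let law_on_ge0 A : (0 <= law_on A)%E. Proof. exact: measure_ge0. Qed.

Let law_on_sigma_additive : semi_sigma_additive law_on.
Proof. exact: measure_semi_sigma_additive. Qed.

HB.instance Definition _ := isMeasure.Build _ _ _ law_on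
  law_on0 law_on_ge0 law_on_sigma_additive.

Let law_on_finite : fin_num_fun law_on.
Proof.
move=> A mA; rewrite /law_on /pushforward /mrestr fin_num_measure//.
by apply: measurableI => //; exact: measurable_funPTI.
Qed.

HB.instance Definition _ := Measure_isFinite.Build _ _ _ law_on law_on_finite.

Lemma ge0_integral_law_on (f : T2 -> \bar R) :
  measurable_fun setT f -> (forall x, 0 <= f x)%E ->
  (\int[law_on]_z f z = \int[P]_(w in D) f (X w))%E.
Proof.
move=> mf f0; rewrite /law_on ge0_integral_pushforward//.
by rewrite preimage_setT integral_mrestr//=; apply: (measurableT_comp mf).
Qed.

End law_on.

(** * Training data and test pair of a classification model *)

Section random_elements.
Context d (T : measurableType d) (R : realType) (K n : nat).
Context (y : n.-tuple 'I_K.+1) (P : 'I_K.+1 -> probability T R).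

Definition attach_labels (t : n.-tuple T) : n.-tuple (T * 'I_K.+1) :=
  [tuple (tnth t i, tnth y i) | i < n].

Lemma measurable_attach_labels : measurable_fun setT attach_labels.
Proof.
apply/measurable_fun_tnthP => i.
rewrite (_ : _ \o _ = fun t : n.-tuple T => (tnth t i, tnth y i)); last first.
  by apply/funext => t /=; rewrite tnth_mktuple.
by apply: measurable_fun_pair => //; exact: measurable_tnth.
Qed.

Variable M : classification_model y P.

Definition train_features (w : Defs.space M) : n.-tuple T :=
  [tuple train i w | i < n].

Definition test_pair (w : Defs.space M) : T * 'I_K.+1 := (feature w, label w).

Local Notation D := (@training_data _ _ _ _ _ _ _ M).

Lemma training_dataE : D = attach_labels \o train_features.
Proof.
by apply/funext => w; apply: eq_from_tnth => i /=; rewrite !tnth_mktuple.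
Qed.

Lemma measurable_train_features : measurable_fun setT train_features.
Proof.
apply/measurable_fun_tnthP => i.
rewrite (_ : _ \o _ = train i); last first.
  by apply/funext => t /=; rewrite tnth_mktuple.
exact: measurable_train.
Qed.

HB.instance Definition _ :=
  isMeasurableFun.Build _ _ _ _ train_features measurable_train_features.

Lemma measurable_test_pair : measurable_fun setT test_pair.
Proof.
by apply: measurable_fun_pair; [exact: measurable_feature|exact: measurable_label].
Qed.

HB.instance Definition _ :=
  isMeasurableFun.Build _ _ _ _ test_pair measurable_test_pair.

Lemma measurable_training_data : measurable_fun setT D.
Proof.
rewrite training_dataE; apply: measurableT_comp.
  exact: measurable_attach_labels.
exact: measurable_train_features.
Qed.

HB.instance Definition _ :=
  isMeasurableFun.Build _ _ _ _ D measurable_training_data.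

Lemma measurable_label_eq b : measurable [set w : Defs.space M | label w = b].
Proof.
rewrite -[X in measurable X]setTI.
by refine (@measurable_label _ _ _ _ _ _ _ M _ [set b] _).
Qed.

Lemma train_features_box A :
  train_features @^-1` box A = \bigcap_i (train i @^-1` A i).
Proof.
apply/seteqP; split=> w Aw i /=; first by have := Aw i; rewrite tnth_mktuple.
by rewrite tnth_mktuple; exact: Aw.
Qed.

Lemma train_features_law :
  is_product_law (fun i => P (tnth y i)) (distribution (prob M) train_features).
Proof.
move=> A mA.
transitivity (prob M (\bigcap_i (train i @^-1` A i))).
  by congr (prob M _); exact: train_features_box.
have := @independence _ _ _ _ _ _ _ M A setT mA measurableT.
rewrite setIT probability_setT mule1 => ->.
by apply: eq_bigr => i _; rewrite train_law.
Qed.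

(** Independence, assumed for the training features one by one, extends to all
    events of the whole training sample: with [E] fixed, both sides are finite
    measures in [C] that agree on boxes. *)
Lemma train_features_test_pair_indep C E : measurable C -> measurable E ->
  (prob M (train_features @^-1` C `&` test_pair @^-1` E)
    = prob M (train_features @^-1` C) * prob M (test_pair @^-1` E))%E.
Proof.
move=> mC mE.
have mZ : measurable (test_pair @^-1` E) by exact: measurable_funPTI.
pose c := NngNum (fine_ge0 (measure_ge0 (prob M) (test_pair @^-1` E))).
have cE : ((c%:num)%:E = prob M (test_pair @^-1` E))%E.
  by rewrite /= fineK// fin_num_measure.
pose m1 := law_on (prob M) mZ train_features.
pose m2 := mscale c (distribution (prob M) train_features).
rewrite muleC -[in RHS]cE; change (m1 C = m2 C).
apply: box_measure_unique mC => [|A mA].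
- by rewrite ltey_eq fin_num_measure.
- rewrite /m2 /m1 /= /mscale cE train_features_law//.
  rewrite /law_on /pushforward /mrestr train_features_box independence// muleC.
  by congr (_ * _)%E; apply: eq_bigr => i _; rewrite train_law.
Qed.

Lemma training_data_test_pair_indep C E : measurable C -> measurable E ->
  (prob M (D @^-1` C `&` test_pair @^-1` E)
    = prob M (D @^-1` C) * prob M (test_pair @^-1` E))%E.
Proof.
move=> mC mE; rewrite training_dataE comp_preimage.
apply: train_features_test_pair_indep => //.
by rewrite -[X in measurable X]setTI; exact: measurable_attach_labels.
Qed.

Lemma training_data_label_indep b C : measurable C ->
  (prob M (D @^-1` C `&` [set w | label w = b])
   = prob M (D @^-1` C) * prob M [set w | label w = b])%E.
Proof.
move=> mC.
have mb : measurable (setT `*` [set b] : set (T * 'I_K.+1)).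
  exact: measurableX.
have pairE : test_pair @^-1` (setT `*` [set b]) = [set w | label w = b].
  by apply/seteqP; split=> w /= => [[]|].
by have := training_data_test_pair_indep mC mb; rewrite pairE.
Qed.

(** As a function of [C] and [A] the left-hand side is the law of the training
    data and the feature on the event [Y = b]; that it factorizes makes this law
    a product measure. *)
Lemma feature_law_training_data b C A : measurable C -> measurable A ->
  (prob M (D @^-1` C `&` ([set w | A (feature w)] `&` [set w | label w = b]))
   = prob M (D @^-1` C `&` [set w | label w = b]) * P b A)%E.
Proof.
move=> mC mA.
have mAb : measurable (A `*` [set b]) by exact: measurableX.
have := training_data_test_pair_indep mC mAb.
rewrite training_data_label_indep// -muleA [X in (_ = _ * X)%E -> _]feature_law//.
by rewrite [(P b A * _)%E]muleC.
Qed.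

(** * Conditional probabilities given the training data *)

(** On the event [Y = b, D \in C], the pair [(D, X)] has as law the product of
    the law of [D] and [P b]; evaluating this product on [S] by sections gives
    the defining equation of a conditional probability. *)
Lemma section_is_cond_prob b (S : set (T * n.-tuple (T * 'I_K.+1))) :
  measurable S ->
  is_cond_prob (prob M) [set w | S (feature w, training_data w)]
    [set w | label w = b] D (fun t => fine (P b (ysection S t))).
Proof.
move=> mS.
have mPS : measurable_fun setT (fun t => P b (ysection S t)).
  exact: measurable_fun_ysection.
split=> [|C mC].
  by apply: (measurableT_comp (@fine_measurable R _ measurableT) mPS).
have mBC : measurable ([set w : Defs.space M | label w = b] `&` D @^-1` C).
  by apply: measurableI; [exact: measurable_label_eq|exact: measurable_funPTI].
pose mu := law_on (prob M) mBC D.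
have mDX : measurable_fun setT (fun w : Defs.space M => (D w, feature w)).
  by apply: measurable_fun_pair; [exact: measurable_training_data|
                                  exact: measurable_feature].
pose DX : {mfun Defs.space M >-> _} :=
  HB.pack (fun w : Defs.space M => (D w, feature w))
    (isMeasurableFun.Build _ _ _ _ _ mDX).
(* the product measure is computed by integrating over its first factor, which
   therefore has to be the training data *)
pose S' := [set z : n.-tuple (T * 'I_K.+1) * T | S (z.2, z.1)].
have mS' : measurable S'.
  rewrite -[X in measurable X]setTI.
  exact: (measurable_fun_pair measurable_snd measurable_fst measurableT mS).
transitivity (law_on (prob M) mBC DX S').
  by rewrite /law_on /pushforward /mrestr -setIA.
rewrite -(@product_measure_unique _ _ _ _ _ mu (P b))//.
  rewrite /product_measure1 ge0_integral_law_on//.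
    apply: eq_integral => w _ /=; rewrite fineK ?fin_num_measure//.
    exact: measurable_ysection.
move=> C' A mC' mA; rewrite /mu /law_on /pushforward /mrestr /=.
have := feature_law_training_data b (measurableI _ _ mC' mC) mA.
rewrite preimage_setI => E.
transitivity (prob M (D @^-1` C' `&` D @^-1` C
    `&` ([set w | A (feature w)] `&` [set w | label w = b]))).
  by congr (prob M _); apply/seteqP; split => w /=; tauto.
rewrite E; congr (_ * _)%E; congr (prob M _).
by apply/seteqP; split => w /=; tauto.
Qed.

(** Let [g] be another version and [C] the set where [g > alpha]. On the event
    [Y = b, D \in C] the integral of [g D] is that of [h D], hence at most
    [alpha] times the probability of this event; as [g D > alpha] there, that
    probability vanishes. Since [Y = b] has positive probability and is
    independent of [D], so does the probability of [D \in C]. *)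
Lemma cond_level_le_of_version p b alpha h :
  0 < alpha -> (forall t, 0 <= h t) ->
  is_cond_prob (prob M) [set w | p (feature w, training_data w) <= alpha]
    [set w | label w = b] D h ->
  {ae prob M, forall w, h (D w) <= alpha} -> cond_level_le M p b alpha.
Proof.
move=> alpha0 h0 [mh hE] h_le g [mg gE].
pose C := [set t | alpha < g t].
have mC : measurable C.
  rewrite -[X in measurable X]setTI.
  exact: (measurable_fun_ltr (measurable_cst alpha) mg).
set B := [set w : Defs.space M | label w = b].
have mB : measurable B by exact: measurable_label_eq.
have mDC : measurable (D @^-1` C) by exact: measurable_funPTI.
have mBC : measurable (B `&` D @^-1` C) by exact: measurableI.
have mD f : measurable_fun setT f ->
    measurable_fun (B `&` D @^-1` C) (fun w => (f (D w))%:E : \bar R).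
  move=> mf; apply/measurable_EFinP; apply: measurable_funTS.
  exact: (measurableT_comp mf measurable_training_data).
have gh : (\int[prob M]_(w in B `&` D @^-1` C) (g (D w))%:E
           <= alpha%:E * prob M (B `&` D @^-1` C))%E.
  rewrite -gE// hE// -integral_cst//; apply: ae_ge0_le_integral => //.
  - by move=> w _; rewrite lee_fin.
  - exact: mD.
  - by move=> w _; rewrite lee_fin ltW.
  - by apply: filterS h_le => w hw _; rewrite lee_fin.
have BC0 : prob M (B `&` D @^-1` C) = 0%E.
  have excess_ge0 w : (B `&` D @^-1` C) w -> (0 <= (g (D w) - alpha)%:E)%E.
    by move=> [_ /ltW]; rewrite lee_fin subr_ge0.
  have mexcess :
      measurable_fun (B `&` D @^-1` C) (fun w => (g (D w) - alpha)%:E).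
    by apply: (mD (fun t => g t - alpha)); exact: measurable_funB.
  have : (\int[prob M]_(w in B `&` D @^-1` C) `|(g (D w) - alpha)%:E| = 0)%E.
    under eq_integral => w /set_mem wBC do rewrite gee0_abs ?excess_ge0//.
    apply/eqP; rewrite eq_le integral_ge0 ?andbT; last exact: excess_ge0.
    rewrite -(@leeD2rE _ (alpha%:E * prob M (B `&` D @^-1` C))%E).
      rewrite add0e -[in leLHS]integral_cst// -ge0_integralD//.
      - by under eq_integral do rewrite -EFinD subrK.
      - by move=> w _; rewrite lee_fin ltW.
    by rewrite fin_numM ?fin_num_measure.
  move/ae_eq_integral_abs => /(_ mBC mexcess)[N [mN N0 subN]].
  apply: (subset_measure0 _ _ _ N0) => // w wBC; apply: subN => /(_ wBC)[] /eqP.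
  by apply/negP; rewrite subr_eq0 gt_eqF//; case: wBC.
exists (D @^-1` C); split => //; last by move=> w /= /negP; rewrite -ltNge.
move: BC0; rewrite setIC training_data_label_indep// => /eqP.
by rewrite mule_eq0 (gt_eqF (label_gt0 M b)) orbF => /eqP.
Qed.

End random_elements.

(** * Existence of models with prescribed class laws *)

Section existence.
Context d (T : measurableType d) (R : realType) (K n : nat).
Context (P : 'I_K.+1 -> probability T R).

Let tag (b : 'I_K.+1) (x : T) : T * 'I_K.+1 := (x, b).

Let measurable_tag b : measurable_fun setT (tag b).
Proof. exact: measurable_fun_pair. Qed.

HB.instance Definition _ b :=
  isMeasurableFun.Build _ _ _ _ (tag b) (measurable_tag b).

(** The law of a test pair whose label is uniformly distributed. Finite sums of
    measures are indexed by [nat], whence [inord]. *)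
Definition uniform_mixture : set (T * 'I_K.+1) -> \bar R :=
  msum (fun b => mscale (K.+1%:R^-1)%:nng
     (distribution (P (inord b)) (tag (inord b)))) K.+1.

HB.instance Definition _ := Measure.on uniform_mixture.

Lemma uniform_mixtureX (A : set T) (b : 'I_K.+1) :
  uniform_mixture (A `*` [set b]) = ((K.+1%:R^-1)%:E * P b A)%E.
Proof.
rewrite /uniform_mixture /msum (bigD1 b)//= big1 ?adde0 => [|c cb].
  rewrite /mscale /= /distribution /pushforward inord_val.
  by congr (_ * P b _)%E; apply/seteqP; split=> [x []|x].
rewrite /mscale /= /distribution /pushforward inord_val.
rewrite (_ : _ @^-1` _ = set0) ?measure0 ?mule0//.
by apply/seteqP; split=> // x [_ /=] /eqP; rewrite (negbTE cb).
Qed.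

Let uniform_mixtureT : uniform_mixture setT = 1%E.
Proof.
rewrite /uniform_mixture /msum /mscale /=.
rewrite (eq_bigr (fun=> (K.+1%:R^-1)%:E)) => [|b _]; last first.
  rewrite /mscale /= /distribution /pushforward preimage_setT.
  by rewrite probability_setT mule1.
by rewrite sumEFin sumr_const card_ord -(mulr_natl (K.+1%:R^-1)) divff.
Qed.

HB.instance Definition _ :=
  Measure_isProbability.Build _ _ _ uniform_mixture uniform_mixtureT.

Lemma uniform_mixture_label b :
  uniform_mixture (snd @^-1` [set b]) = (K.+1%:R^-1)%:E.
Proof. by rewrite -setTX uniform_mixtureX probability_setT mule1. Qed.

(** The coordinates on the product of [nu] and the mixture law. *)
Lemma product_model (y : n.-tuple 'I_K.+1)
    (nu : probability (n.-tuple T) R) :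
  is_product_law (fun i => P (tnth y i)) nu -> classification_model y P.
Proof.
move=> nuP.
pose W := (n.-tuple T * (T * 'I_K.+1))%type.
pose X i (w : W) := tnth w.1 i.
have mX i : measurable_fun setT (X i).
  by apply: (measurableT_comp (measurable_tnth i)).
have boxW (A : 'I_n -> set T) : \bigcap_i (X i @^-1` A i) = fst @^-1` (box A).
  by apply/seteqP; split=> [w Aw i|w Aw i _]; [exact: (Aw i Logic.I)|exact: Aw].
have nuX (C : set (n.-tuple T)) : measurable C ->
    (nu \x uniform_mixture)%E (fst @^-1` C) = nu C.
  move=> mC; rewrite -setXT product_measure1E//.
  by rewrite [Z in (_ * Z)%E]uniform_mixtureT mule1.
have mixX E : measurable E ->
    (nu \x uniform_mixture)%E (snd @^-1` E) = uniform_mixture E.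
  move=> mE; rewrite -setTX product_measure1E//.
  by rewrite [Z in (Z * _)%E](probability_setT nu) mul1e.
have mlabel b : measurable (snd @^-1` [set b] : set (T * 'I_K.+1)).
  by rewrite -setTX; exact: measurableX.
have trainX i (A : set T) : measurable A ->
    (nu \x uniform_mixture)%E (X i @^-1` A) = P (tnth y i) A.
  (* the event is a box with a single constrained side *)
  move=> mA; pose B j := if j == i then A else setT.
  have mB j : measurable (B j) by rewrite /B; case: ifP.
  rewrite (_ : _ @^-1` _ = fst @^-1` box B).
    rewrite nuX ?nuP//; last exact: measurable_box.
    rewrite (bigD1 i)//= big1 ?mule1 => [|j /negbTE ji]; rewrite /B ?eqxx ?ji//.
    exact: probability_setT.
  apply/seteqP; split=> w /= => [Aw j|/(_ i)]; rewrite /B ?eqxx//.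
  by case: eqP => [->|].
refine (@Build_classification_model d T R K n y P _ _
  (nu \x uniform_mixture)%E X (fun w => w.2.1) (fun w => w.2.2)
  mX _ _ trainX _ _ _).
- exact: (measurableT_comp measurable_fst measurable_snd).
- exact: (measurableT_comp measurable_snd measurable_snd).
- move=> b; rewrite [ltRHS](mixX (snd @^-1` [set b]))//.
  by rewrite uniform_mixture_label lte_fin invr_gt0.
- move=> b A mA.
  rewrite [LHS](mixX (A `*` [set b])); last exact: measurableX.
  rewrite [Z in (_ * Z)%E](mixX (snd @^-1` [set b]))//.
  by rewrite uniform_mixtureX uniform_mixture_label muleC.
- move=> A E mA mE; rewrite boxW.
  have EE : [set w : W | E (w.2.1, w.2.2)] = snd @^-1` E.
    by apply/seteqP; split=> -[? []].
  rewrite EE [Z in (_ * Z)%E](mixX E)//.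
  rewrite [LHS](product_measure1E _ _ (measurable_box mA) mE) nuP//.
  by congr (_ * _)%E; apply: eq_bigr => i _; exact/esym/trainX.
Qed.

End existence.

(** * The level of the p-value in all classes *)

Theorem lemma3p4 (d : measure_display) (T : measurableType d) (R : realType)
    (K n : nat)
    (Q : 'I_K.+2 -> probability T R) (hQ : mutually_abs_continuous Q)
    (y : n.-tuple 'I_K.+2) (theta : 'I_K.+2) (alpha : R) (halpha : 0 < alpha < 1)
    (p : T * n.-tuple (T * 'I_K.+2) -> R) (hp : p_value p)
    (hlevel : forall (s : 'S_K.+2)
        (M : classification_model y (fun b => Q (s b))),
      cond_level_le M p theta alpha) :
  forall (b : 'I_K.+2) (s : 'S_K.+2)
      (M : classification_model y (fun c => Q (s c))),
    cond_level_le M p b alpha.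
Proof.
move=> b s M.
have [alpha0 _] := andP halpha; have [mp _] := hp.
have mS : measurable [set z | p z <= alpha].
  rewrite -[X in measurable X]setTI.
  exact: (measurable_fun_ler mp (measurable_cst alpha)).
pose s' := (tperm theta b * s)%g.
have s'theta : s' theta = s b by rewrite permM tpermL.
have [nu nuP] := product_law_exists (fun i : 'I_n => Q (s' (tnth y i))).
have M' := product_model (P := fun c => Q (s' c)) nuP.
pose h t := fine (Q (s b) (ysection [set z | p z <= alpha] t)).
have h_version := section_is_cond_prob M b mS.
have h_version' : is_cond_prob (prob M')
    [set w | p (feature w, training_data w) <= alpha]
    [set w | label w = theta] (@training_data _ _ _ _ _ _ _ M') h.
  by rewrite /h -s'theta; exact: (section_is_cond_prob M' theta mS).
apply: (cond_level_le_of_version alpha0 _ h_version).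
  by move=> t; exact: fine_ge0.
pose N := [set t | alpha < h t].
have mN : measurable N.
  rewrite -[X in measurable X]setTI.
  by apply: (measurable_fun_ltr (measurable_cst alpha)); case: h_version.
have mlN : measurable (attach_labels y @^-1` N).
  by rewrite -[X in measurable X]setTI; exact: measurable_attach_labels.
have mDN (s0 : 'S_K.+2) (M0 : classification_model y (fun c => Q (s0 c))) :
    measurable (@training_data _ _ _ _ _ _ _ M0 @^-1` N).
  exact: measurable_funPTI.
have N0 : prob M' (@training_data _ _ _ _ _ _ _ M' @^-1` N) = 0%E.
  apply/negligibleP; first exact: mDN.
  apply: negligibleS (hlevel _ _ _ h_version') => w.
  by rewrite /N /= ltNge => /negP.
have /null_content_dominatesP dom := product_law_dominates
  (fun i => hQ (s (tnth y i)) (s' (tnth y i)))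
  (train_features_law M) (train_features_law M').
exists (@training_data _ _ _ _ _ _ _ M @^-1` N); split.
- exact: mDN.
- rewrite training_dataE comp_preimage; apply: dom => //.
  by move: N0; rewrite training_dataE comp_preimage.
- by move=> w /= /negP; rewrite -ltNge.
Qed.
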